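(* Let $J\ge3$, let $V_1,\dots,V_J$ and $W$ be real Hilbert spaces, $g\in W$, $F_j\colon V_j\to\overline{\mathbb{R}}$ proper, convex, and lower semicontinuous, and $B_j\colon V_j\to W$ bounded and linear ($1\le j\le J$). Consider the problem $$\min_{v_j\in V_j}\sum_{j=1}^JF_j(v_j)\quad\text{subject to}\quad\sum_{j=1}^JB_jv_j=g.\qquad(\mathrm{P})$$ Let $\beta>0$ and suppose that the functions $H_j\colon W^*\to\overline{\mathbb{R}}$ defined by $$H_j(q)=\begin{cases}F_j^*(-B_j^*q),&1\le j\le J-2,\\ F_j^*(-B_j^*q)-\frac{1}{2\beta}\|q\|^2,&j=J-1,J,\end{cases}$$ are convex. Then the dualization-based ADMM (algorithm (A) in the context) for (P) is a dualization of the Peaceman--Rachford splitting algorithm (algorithm (PR) in the context) for solving the dual problem $$\min_{q\in W^*}\Big\{\frac1\beta\|q\|^2+(q,g)+\sum_{j=1}^JH_j(q)\Big\}.$$ More precisely, if $s_j^{(0)}=r_j^{(0)}$ for $1\le j\le J$ and $\lambda^{(0)}=p^{(0)}$, then $$s_j^{(n)}=r_j^{(n)},\quad\lambda^{(n)}=p^{(n)},\quad -B_j^*p^{(n)}\in\partial F_j(u_j^{(n)}),\quad 1\le j\le J,\ n\ge1.$$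
   Context: Notation: $\overline{\mathbb{R}}=\mathbb{R}\cup\{\pm\infty\}$; $(\cdot,\cdot)$ denotes inner products and duality pairings; an element of a dual space and its Riesz representative are denoted by the same symbol (so $W$ and $W^*$ are identified in the update formulas); $B_j^*\colon W^*\to V_j^*$ is the adjoint; $F_j^*(\xi)=\sup_{v\in V_j}\{(\xi,v)-F_j(v)\}$ is the Legendre--Fenchel conjugate; $\partial$ is the convex subdifferential. Algorithm (PR): choose $p^{(0)}\in W^*$ and $(r_1^{(0)},\dots,r_J^{(0)})\in W^J$; for $n=0,1,2,\dots$ and $j=1,\dots,J$ successively set $$p^{(n+\frac{j}{J})}=\arg\min_{q\in W^*}\Big\{\frac1\beta\|q-p^{(n+\frac{j-1}{J})}\|^2+(q,r_j^{(n)})+H_j(q)\Big\},\quad r_j^{(n+1)}=r_j^{(n)}+\frac2\beta\big(p^{(n+\frac{j}{J})}-p^{(n+\frac{j-1}{J})}\big).$$ Algorithm (A): set $\gamma_j=\frac12$ for $1\le j\le J-2$ and $\gamma_j=1$ for $j=J-1,J$. Choose $(s_1^{(0)},\dots,s_J^{(0)})\in W^J$ and $\lambda^{(0)}\in W^*$. For $n=0,1,2,\dots$: for $j=1,\dots,J$ successively, $$\hat{u}_j^{(n+1)}\in\arg\min_{v_j\in V_j}\Big\{F_j(v_j)+2\gamma_j(\lambda^{(n+\frac{j-1}{J})},B_jv_j-s_j^{(n)})+\frac{\gamma_j\beta}{2}\|B_jv_j-s_j^{(n)}\|^2\Big\},$$ $$\lambda^{(n+\frac{j}{J})}=2\gamma_j\lambda^{(n+\frac{j-1}{J})}+\gamma_j\beta\big(B_j\hat{u}_j^{(n+1)}-s_j^{(n)}\big),\quad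 s_j^{(n+1)}=s_j^{(n)}+\frac2\beta\big(\lambda^{(n+\frac{j}{J})}-\lambda^{(n+\frac{j-1}{J})}\big);$$ then choose $(u_1^{(n+1)},\dots,u_J^{(n+1)})\in\prod_{j=1}^JV_j$ such that $-B_j^*\lambda^{(n+1)}\in\partial F_j(u_j^{(n+1)})$ for $1\le j\le J$. Dualization (definition): a primal method is a dualization of a dual method $\{p^{(n)}\}$ if, for any initial configuration of the dual algorithm, there is an initial configuration of the primal algorithm such that the primal--dual relation holds at every iterate $n\ge1$. The underlying primal problem here is (P) with the last block eliminated, in the variables $(v_1,\dots,v_{J-1})$, namely $\min\{\sum_{j=1}^{J-1}F_j(v_j)+((-B_J)\triangleright F_J)(\sum_{j=1}^{J-1}B_jv_j-g)\}$, and the relation is $-B_j^*p^{(n)}\in\partial F_j(u_j^{(n)})$, $1\le j\le J-1$. Here $(\Pi\triangleright F)(w)=\inf_{\Pi v=w}F(v)$ denotes infimal postcomposition. Standing assumptions: $(-B_J)\triangleright F_J$ is proper and lower semicontinuous and the infimum in its definition is attained; every minimization subproblem defining an iterate admits a solution and the algorithms are well defined (all indicated choices are possible); whenever Fenchel--Rockafellar duality is used (for the global problem and the local subproblems), the strong duality qualification condition holds: for a problem $\min_{v}\{\Phi(v)+\Gamma(Bv)\}$, the function $w\mapsto\inf_{v}\{\Phi(v)+\Gamma(Bv+w)\}$ is subdifferentiable at $w=0$. *)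

(* Defs.v *)
From HB Require Import structures.
From mathcomp Require Import all_boot all_order all_algebra.
From mathcomp Require Import all_classical all_reals all_analysis.

Set Implicit Arguments.
Unset Strict Implicit.
Unset Printing Implicit Defensive.

Import Order.TTheory GRing.Theory Num.Theory.
Import numFieldNormedType.Exports.

Local Open Scope classical_set_scope.
Local Open Scope ring_scope.

(* Real Hilbert spaces: complete normed modules whose norm is induced by an
   inner product. *)
HB.mixin Record CompleteNormedModule_isHilbert (R : realType) V
    of CompleteNormedModule R V := {
  inner : {dot V for (@idfun R)} ;
  inner_normE : forall x : V, inner x x = `|x| ^+ 2
}.

#[short(type="hilbertType")]
HB.structure Definition Hilbert (R : realType) :=
  { V of CompleteNormedModule_isHilbert R V & CompleteNormedModule R V }.

Section ConvexAnalysis.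
Context {R : realType}.
Local Open Scope ereal_scope.

Definition eproper (T : Type) (F : T -> \bar R) : Prop :=
  (forall v, F v != -oo) /\ (exists v, F v < +oo).

(* Only applied to functions that never take the value -oo. *)
Definition econvex (V : lmodType R) (F : V -> \bar R) : Prop :=
  forall (t : R) (x y : V), (0 < t < 1)%R ->
    F ((1 - t) *: x + t *: y)%R <= (1 - t)%:E * F x + t%:E * F y.

Definition is_argmin (T : Type) (f : T -> \bar R) (x : T) : Prop :=
  forall y, f x <= f y.

(* Elements of a dual space V^* are represented by functions V -> R. *)
Definition conjugate (T : Type) (F : T -> \bar R) (xi : T -> R) : \bar R :=
  ereal_sup (range (fun v => (xi v)%:E - F v)).

(* xi \in \partial F(u) *)
Definition subdiff (V : zmodType) (F : V -> \bar R) (u : V) (xi : V -> R)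
    : Prop :=
  F u \is a fin_num /\ forall v, F u + (xi (v - u)%R)%:E <= F v.

(* B^* : W^* -> V^*, with W^* identified with W through the inner product. *)
Definition adjoint (T : Type) (W : hilbertType R) (B : T -> W) (q : W)
    : T -> R := fun v => inner q (B v).

Definition inf_postcomp (T W : Type) (Pi : T -> W) (F : T -> \bar R) (w : W)
    : \bar R := ereal_inf [set F v | v in [set v | Pi v = w]].

Definition inf_postcomp_attained (T W : Type) (Pi : T -> W) (F : T -> \bar R)
    : Prop :=
  forall w, (exists v, Pi v = w) ->
    exists2 v, Pi v = w & F v = inf_postcomp Pi F w.

(* Strong duality qualification condition for min_v Phi v + Gamma (A v). *)
Definition qualified (T : Type) (W : hilbertType R) (Phi : T -> \bar R)
    (Gamma : W -> \bar R) (A : T -> W) : Prop :=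
  exists q : W,
    subdiff (fun w => ereal_inf (range (fun v => Phi v + Gamma (A v + w)%R)))
      0%R (inner q).

(* Objective of the Fenchel--Rockafellar dual of min_v Phi v + Gamma (A v). *)
Definition FR_dual_obj (T : Type) (W : hilbertType R) (Phi : T -> \bar R)
    (Gamma : W -> \bar R) (A : T -> W) (q : W) : \bar R :=
  conjugate Phi (\- adjoint A q)%R + conjugate Gamma (inner q).

End ConvexAnalysis.

(* A method is given by the relation between its initial configurations and
   the sequences of iterates it can generate from them. The iterates of index
   0 are not constrained by rel. Requiring that the primal method generates
   some sequence from c excludes vacuous choices of c. *)
Definition is_dualization (Cd Cp X Y : Type)
    (dual : Cd -> (nat -> Y) -> Prop) (primal : Cp -> (nat -> X) -> Prop)
    (rel : Y -> X -> Prop) : Prop :=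
  forall d : Cd, exists2 c : Cp, exists u, primal c u &
    forall p u, dual d p -> primal c u ->
      forall n, (1 <= n)%N -> rel (p n) (u n).

(* The blocks 1, ..., J are numbered 0, ..., J - 1 here. *)
Section Blocks.
Context {R : realType} {J : nat} {V : 'I_J -> hilbertType R}
  {W : hilbertType R}.
Context (F : forall j, V j -> \bar R) (B : forall j, {linear V j -> W}).
Context (g : W) (beta : R).

Definition Hfun (j : 'I_J) (q : W) : \bar R :=
  let h := conjugate (@F j) (\- adjoint (B j) q) in
  if (j.+2 < J)%N then h else (h - ((2 * beta)^-1 * `|q| ^+ 2)%:E)%E.

Definition dual_obj (q : W) : \bar R :=
  ((beta^-1 * `|q| ^+ 2 + inner q g)%:E + \sum_(j < J) Hfun j q)%E.

Definition PR_obj (j : 'I_J) (p0 r q : W) : \bar R :=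
  ((beta^-1 * `|q - p0| ^+ 2 + inner q r)%:E + Hfun j q)%E.

(* p m is the iterate of index m / J: the iterate written p^(n + j/J),
   1 <= j <= J, is p (n * J + j), and p^(n) is p (n * J). *)
Definition PR_run (p : nat -> W) (r : nat -> 'I_J -> W) : Prop :=
  forall (n : nat) (j : 'I_J), let m := (n * J + j)%N in
    is_argmin (PR_obj j (p m) (r n j)) (p m.+1) /\
    r n.+1 j = r n j + (2 / beta) *: (p m.+1 - p m).

Definition gamma (j : 'I_J) : R := if (j.+2 < J)%N then 2^-1 else 1.

(* The subproblem of block j is min_v F_j v + ADMM_penalty j lam s (B_j v). *)
Definition ADMM_penalty (j : 'I_J) (lam s w : W) : \bar R :=
  (2 * gamma j * inner lam (w - s) + gamma j * beta / 2 * `|w - s| ^+ 2)%:E.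

(* lam is indexed as p in PR_run; u 0 and uhat 0 are irrelevant. *)
Definition ADMM_run (s : nat -> 'I_J -> W) (lam : nat -> W)
    (uhat u : nat -> forall j, V j) : Prop :=
  forall n : nat,
    (forall j : 'I_J, let m := (n * J + j)%N in
      [/\ is_argmin
            (fun v => F v + ADMM_penalty j (lam m) (s n j) (B j v))%E
            (uhat n.+1 j),
          lam m.+1 = (2 * gamma j) *: lam m
                     + (gamma j * beta) *: (B j (uhat n.+1 j) - s n j) &
          s n.+1 j = s n j + (2 / beta) *: (lam m.+1 - lam m)]) /\
    (forall j : 'I_J,
      subdiff (@F j) (u n.+1 j) (\- adjoint (B j) (lam (n.+1 * J)%N))).

Definition PR_method (c : W * ('I_J -> W)) (q : nat -> W) : Prop :=
  exists p r, [/\ PR_run p r, p 0%N = c.1, r 0%N = c.2 &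
    forall n, q n = p (n * J)%N].

Definition ADMM_method (c : W * ('I_J -> W)) (u : nat -> forall j, V j)
    : Prop :=
  exists s lam uhat,
    [/\ ADMM_run s lam uhat u, lam 0%N = c.1 & s 0%N = c.2].

(* The problem with the last block jl eliminated; its variables are indexed
   by lift jl i, i : 'I_J.-1. *)
Context (jl : 'I_J).

Definition red_var : Type := forall i : 'I_J.-1, V (lift jl i).

Definition restrict_last (u : forall j, V j) : red_var :=
  fun i => u (lift jl i).

Definition red_Phi (v : red_var) : \bar R :=
  (\sum_(i < J.-1) F (v i))%E.

Definition red_B (v : red_var) : W := \sum_(i < J.-1) B (lift jl i) (v i).

Definition last_postcomp : W -> \bar R :=
  inf_postcomp (fun v => - B jl v) (@F jl).

Definition red_Gamma (w : W) : \bar R := last_postcomp (w - g).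

Definition red_ADMM_method (c : W * ('I_J -> W)) (u' : nat -> red_var)
    : Prop :=
  exists u, ADMM_method c u /\ u' = fun n => restrict_last (u n).

Definition primal_dual_rel (p : W) (v : red_var) : Prop :=
  forall i : 'I_J.-1,
    subdiff (@F (lift jl i)) (v i) (\- adjoint (B (lift jl i)) p).

End Blocks.

Arguments red_Phi {R J V} F jl v.
Arguments red_B {R J V W} B jl v.
Arguments red_ADMM_method {R J V W} F B beta jl c u'.
Arguments primal_dual_rel {R J V W} F B jl p v.

Lemma last_block_subproof (J : nat) (hJ : (3 <= J)%N) : (J.-1 < J)%N.
Proof. by case: J hJ. Qed.

Definition last_block (J : nat) (hJ : (3 <= J)%N) : 'I_J :=
  Ordinal (last_block_subproof hJ).

(* Main.v *)
Require Import Defs.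
From mathcomp Require Import all_boot all_order all_algebra.
From mathcomp Require Import all_classical all_reals all_analysis.
From mathcomp Require Import ring lra.

Import Order.TTheory GRing.Theory Num.Theory.
Import numFieldNormedType.Exports.
Local Open Scope ring_scope.

(** Both methods perform the same step on the dual variable.  The first-order
    condition of the subproblem of block [j], solved at [uhat], reads
    [- B_j^* lam' \in \partial F_j(uhat)], where [lam'] is the gradient of the
    quadratic penalty at [B_j uhat]; this gradient is exactly the multiplier
    update (lemma [ADMM_subproblem_subdiff]).  By Fenchel's equality,
    [- B_j uhat] is then a subgradient of [q |-> F_j^*(- B_j^* q)] at [lam'].
    Adding the quadratic part of the Peaceman--Rachford objective, whose
    gradient at [lam'] is [B_j uhat], shows that [lam'] minimizes this
    objective, and even that the objective grows at least like
    [(2 beta)^-1 |q - lam'|^2] away from [lam'] (lemma [PR_obj_growth]).  For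
    the last two blocks [H_j] carries the concave term [- |q|^2 / (2 beta)],
    which is beaten by [|q - p0|^2 / beta], so that growth persists; it is this
    term that turns [gamma_j = 1/2] into [gamma_j = 1].  The
    Peaceman--Rachford minimizer is therefore unique and equal to [lam'], the
    updates of [s] and [r] coincide, and induction on the iterations gives
    equality of the two runs (lemma [runs_agree]).

    The dual of the reduced problem is computed directly.  The conjugate of the
    separable part is the sum of the conjugates, since a supremum over
    independent variables of a sum is the sum of the suprema (lemma
    [ereal_sup_sum_indep]); the conjugate of the infimal postcomposition
    shifted by [g] contributes [(q, g)] and the conjugate of the last block
    (lemma [conjugate_red_Gamma]); and the two terms [- |q|^2 / (2 beta)]
    hidden in [H_{J-1}] and [H_J] cancel [|q|^2 / beta] (lemma
    [FR_dual_objE]). *)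

(** * Inner products *)

Section Inner.
Context {R : realType} {W : hilbertType R}.
Implicit Types x y z : W.

Lemma inner_sym x y : inner x y = inner y x.
Proof. by rewrite hermC /= expr0 mul1r. Qed.

Lemma innerDl x y z : inner (x + y) z = inner x z + inner y z.
Proof. exact: linearDl. Qed.

Lemma innerDr x y z : inner x (y + z) = inner x y + inner x z.
Proof. exact: linearDr. Qed.

Lemma innerBl x y z : inner (x - y) z = inner x z - inner y z.
Proof. exact: linearBl. Qed.

Lemma innerBr x y z : inner x (y - z) = inner x y - inner x z.
Proof. exact: linearBr. Qed.

Lemma innerZr (a : R) x y : inner x (a *: y) = a * inner x y.
Proof. exact: linearZr_LR. Qed.

Lemma innerZl (a : R) x y : inner (a *: x) y = a * inner x y.
Proof. exact: linearZl_LR. Qed.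

Lemma norm_sqrD x y : `|x + y| ^+ 2 = `|x| ^+ 2 + 2 * inner x y + `|y| ^+ 2.
Proof.
by rewrite -!inner_normE innerDl !innerDr (inner_sym y x); ring.
Qed.

Lemma norm_sqrZ (a : R) x : `|a *: x| ^+ 2 = a ^+ 2 * `|x| ^+ 2.
Proof. by rewrite normrZ exprMn real_normK ?num_real. Qed.

End Inner.

(** * Subgradients from minimizers, and conjugates *)

(** Lets the step length [t] tend to 0 without taking a limit. *)
Lemma le0_small_slope (R : realFieldType) (d k : R) :
  (forall t, 0 < t < 1 -> d <= t * k) -> d <= 0.
Proof.
move=> dk; rewrite leNgt; apply/negP => d0.
have k0 : 0 < k by have := dk 2^-1 ltac:(lra); nra.
have dk0 : 0 < d + 2 * k by lra.
(* A step below both [1] and [d / k], so that [t * k < d]. *)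
have t01 : 0 < d / (d + 2 * k) < 1.
  by rewrite divr_gt0//= ltr_pdivrMr// mul1r; lra.
have := dk _ t01; rewrite mulrAC ler_pdivlMr//; nra.
Qed.

Section Subdiff.
Context {R : realType}.

(** First-order optimality, with smoothness of [G] at [A u] replaced by a
    quadratic upper bound of slope [q].  Moving from [u] to
    [(1 - t) u + t v] changes [F] by at most [t (F v - F u)] by convexity and
    [G \o A] by at most [t (q, A (v - u)) + O(t^2)]; dividing by [t] yields the
    subgradient inequality as [t] tends to 0. *)
Lemma argmin_add_smooth_subdiff (V : lmodType R) (W : hilbertType R)
    (F : V -> \bar R) (A : {linear V -> W}) (G : W -> R) (q : W) (k : R)
    (u : V) :
  eproper F -> econvex F ->
  (forall z, G z <= G (A u) + inner q (z - A u) + k * `|z - A u| ^+ 2) ->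
  is_argmin (fun v => F v + (G (A v))%:E)%E u ->
  subdiff F u (\- adjoint A q).
Proof.
move=> [FNy [x Fx]] Fcvx Gq umin.
have Fu : F u \is a fin_num.
  rewrite fin_numE FNy /=; apply/eqP => Fuy.
  by have := umin x; rewrite Fuy leNgt /= lte_add_pinfty ?ltry.
split=> // v; have := FNy v.
case Fv : (F v) => [b| |] // _; last by rewrite leey.
case Fua : (F u) Fu => [a| |] // _.
rewrite -EFinD lee_fin /adjoint /= raddfB -subr_le0.
set e := A v - A u.
apply: (@le0_small_slope _ _ (k * `|e| ^+ 2)) => t /[dup] t01 /andP[t0 t1].
have := Fcvx t u v t01; have := umin ((1 - t) *: u + t *: v).
have -> : A ((1 - t) *: u + t *: v) = A u + t *: e.
  by rewrite linearD !linearZ /= scalerBl scale1r scalerBr addrAC addrA.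
have := Gq (A u + t *: e); rewrite [A u + _]addrC addrK norm_sqrZ linearZ /=.
move=> le1; rewrite Fua Fv -!EFinM -EFinD.
have := FNy ((1 - t) *: u + t *: v).
case: (F _) => [c| |] //= _; rewrite -!EFinD !lee_fin => le2 le3.
rewrite -(ler_pM2l t0); nra.
Qed.

(** Fenchel's equality at [p], and the subgradient [- A u] it provides for
    [q |-> F^*(- A^* q)]: both come from comparing the supremum defining the
    conjugate with its term at [u]. *)
Lemma subdiff_conjugate (V : zmodType) (W : hilbertType R) (F : V -> \bar R)
    (A : {additive V -> W}) (u : V) (p : W) :
  subdiff F u (\- adjoint A p) ->
  exists2 c : R, conjugate F (\- adjoint A p) = c%:E &
    forall q, ((c - inner (q - p) (A u))%:E
               <= conjugate F (\- adjoint A q)%R)%E.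
Proof.
move=> [Fu sub]; case Fua : (F u) Fu sub => [a| |] // _ sub.
exists (- inner p (A u) - a).
  apply/eqP; rewrite eq_le; apply/andP; split.
    apply: ge_ereal_sup => _ [v _ <-]; have := sub v.
    rewrite /adjoint /= raddfB linearBr /=.
    case: (F v) => [b| |] //=; rewrite -?EFinD ?lee_fin; last by rewrite leNye.
    lra.
  by apply: ereal_sup_ubound; exists u; rewrite // Fua.
move=> q; apply: ereal_sup_ubound; exists u => //; rewrite Fua -EFinB.
by congr EFin; rewrite /adjoint /= linearBl /=; ring.
Qed.

End Subdiff.

(** * Comparison of the two methods *)

Section Step.
Context {R : realType} {J : nat} {V : 'I_J -> hilbertType R}
  {W : hilbertType R}.
Context (F : forall j, V j -> \bar R) (B : forall j, {linear V j -> W}).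
Context (beta : R) (beta_gt0 : 0 < beta).

(** Since [(2^-1 - gamma j) / beta] is [0] or [- (2 beta)^-1], the two kinds of
    blocks can be treated by one computation. *)
Lemma HfunE (j : 'I_J) (q : W) :
  Hfun F B beta j q = (conjugate (F j) (\- adjoint (B j) q)%R
                       + ((2^-1 - gamma j) / beta * `|q| ^+ 2)%:E)%E.
Proof.
rewrite /Hfun /gamma; case: ifP => _; first by rewrite subrr !mul0r adde0.
congr (_ + _)%E; rewrite -EFinN; congr EFin; rewrite invfM.
by field; rewrite gt_eqF.
Qed.

(** Completing the square at [p]: the quadratic part of the objective has
    gradient [B_j u] at [p], by the choice of [p], and cancels the slope
    [- B_j u] of the conjugate.  What remains is the curvature
    [(3/2 - gamma_j) / beta], which is at least [(2 beta)^-1]. *)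
Lemma PR_obj_growth (j : 'I_J) (p0 r : W) (u : V j)
    (p := (2 * gamma j) *: p0 + (gamma j * beta) *: (B j u - r)) :
  subdiff (F j) u (\- adjoint (B j) p) ->
  exists2 c : R, PR_obj F B beta j p0 r p = c%:E &
    forall q, ((c + (2 * beta)^-1 * `|q - p| ^+ 2)%:E
               <= PR_obj F B beta j p0 r q)%E.
Proof.
move=> /subdiff_conjugate[c cp cq].
rewrite /PR_obj HfunE cp -!EFinD; eexists; first reflexivity.
move=> q; rewrite /PR_obj HfunE; have := cq q.
case: (conjugate _ _) => [h| |] //=; last by move=> _; exact: leey.
rewrite -!EFinD !lee_fin => ch.
have g12 : gamma j = 2^-1 :> R \/ gamma j = 1 :> R.
  by rewrite /gamma; case: ifP; [left|right].
have bn0 : beta != 0 by exact: lt0r_neq0.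
have gn0 : gamma j != 0 :> R.
  by case: g12 => ->; rewrite ?invr_eq0 ?pnatr_eq0 ?oner_eq0.
(* Solve the definition of [p] for [r], then use [p], [d = q - p] and
   [e = p - p0] as independent vectors. *)
have rE : r = B j u - (gamma j * beta)^-1 *: (p - (2 * gamma j) *: p0).
  by rewrite /p addrAC subrr add0r scalerA mulVf ?mulf_neq0// scale1r subKr.
clear cp cq; clearbody p; rewrite {}rE; move: (gamma j) g12 gn0 => g g12 gn0.
set d := q - p in ch *; have -> : q = p + d by rewrite /d addrC subrK.
set e := p - p0; have -> : p0 = p - e by rewrite /e subKr.
have -> : p + d - (p - e) = d + e by rewrite opprB addrC addrA subrK addrC.
clearbody d e; move: (B j u) ch => b ch.
have d0 : 0 <= `|d| ^+ 2 by rewrite exprn_ge0.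
rewrite !norm_sqrD !(innerDl, innerBr, innerZr) -!inner_normE (inner_sym d p).
rewrite -inner_normE in d0.
(* The bracket is the subgradient inequality; the last term is the curvature
   in excess of [(2 beta)^-1]. *)
rewrite -subr_ge0; set lhs := (X in 0 <= _ - X); set rhs := (X in 0 <= X - _).
have -> : rhs - lhs = (h - c + inner d b) + (1 - g) / beta * inner d d.
  by rewrite /rhs /lhs; case: g12 => ->; field.
have : 0 <= (1 - g) / beta.
  by rewrite divr_ge0 ?(ltW beta_gt0)//; case: g12 => ->; lra.
nra.
Qed.

Lemma PR_argmin_unique (j : 'I_J) (p0 r p' : W) (u : V j)
    (p := (2 * gamma j) *: p0 + (gamma j * beta) *: (B j u - r)) :
  subdiff (F j) u (\- adjoint (B j) p) ->
  is_argmin (PR_obj F B beta j p0 r) p' -> p' = p.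
Proof.
move=> /PR_obj_growth[c cp growth] /(_ p).
move: (growth p') => /le_trans /[apply]; rewrite -/p cp lee_fin gerDl.
rewrite pmulr_rle0 ?invr_gt0 ?mulr_gt0// => p'p.
have /eqP : `|p' - p| ^+ 2 == 0 by rewrite eq_le p'p exprn_ge0.
by move/eqP; rewrite expf_eq0 /= normr_eq0 subr_eq0 => /eqP.
Qed.

(** The multiplier update is the gradient of the penalty at [B_j u]. *)
Lemma ADMM_subproblem_subdiff (j : 'I_J) (lam s : W) (u : V j) :
  eproper (F j) -> econvex (F j) ->
  is_argmin (fun v => F j v + ADMM_penalty beta j lam s (B j v))%E u ->
  subdiff (F j) u
    (\- adjoint (B j)
       ((2 * gamma j) *: lam + (gamma j * beta) *: (B j u - s))).
Proof.
move=> Fp Fc; apply: (@argmin_add_smooth_subdiff _ _ _ _ _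
  (fun w => 2 * gamma j * inner lam (w - s)
            + gamma j * beta / 2 * `|w - s| ^+ 2)
  _ (gamma j * beta / 2)) => // z.
set w := B j u; set e := z - w; have -> : z - s = (w - s) + e.
  by rewrite /e [RHS]addrC addrA subrK.
move: (w - s) e => x e; rewrite norm_sqrD innerDl innerDr !innerZl.
rewrite le_eqVlt; apply/orP; left.
by apply/eqP; field.
Qed.

(** Within a sweep, each block only needs the multiplier left by the previous
    block, so an inner induction over the blocks carries equality through the
    sweep; the updates of [s] and [r] then have equal increments. *)
Lemma runs_agree p r s lam uhat u :
  (forall j, eproper (F j)) -> (forall j, econvex (F j)) ->
  PR_run F B beta p r -> ADMM_run F B beta s lam uhat u ->
  (forall j, s 0%N j = r 0%N j) -> lam 0%N = p 0%N ->
  forall n, lam (n * J)%N = p (n * J)%N /\ forall j, s n j = r n j.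
Proof.
move=> Fp Fc PR AD s0 l0; elim=> [|n [IHl IHs]]; first by rewrite mul0n.
have step (j : 'I_J) : lam (n * J + j)%N = p (n * J + j)%N ->
    lam (n * J + j).+1 = p (n * J + j).+1.
  move=> lp; have [/(_ j)[amin -> _] _] := AD n; have [pmin _] := PR n j.
  have sub := ADMM_subproblem_subdiff _ _ _ _ (Fp j) (Fc j) amin.
  by apply/esym/(PR_argmin_unique _ _ _ _ _ sub); rewrite lp IHs.
have lamp k : (k <= J)%N -> lam (n * J + k)%N = p (n * J + k)%N.
  elim: k => [|k IHk] kJ; first by rewrite addn0.
  by rewrite addnS; apply: (step (Ordinal kJ)); apply: IHk; apply: ltnW.
split; first by rewrite mulSn addnC lamp.
move=> j; have [/(_ j)[_ _ ->] _] := AD n; have [_ ->] := PR n j.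
by rewrite IHs -addnS !lamp// ltnW.
Qed.

End Step.

(** * Suprema of separable sums *)

Section SupSum.
Context {R : realType}.
Local Open Scope ereal_scope.

(** A real strictly below each summand is the form of approximation that
    treats [+oo] like any other value; subtracting a tolerance would not. *)
Lemma lt_adde_split (x a b : \bar R) : x < a + b ->
  exists y z : R, [/\ y%:E < a, z%:E < b & x < (y + z)%:E].
Proof.
case: x a b => [x| |] [a| |] [b| |] //=; rewrite -?EFinD ?lte_fin => xab.
- exists (a - (a + b - x) / 3)%R, (b - (a + b - x) / 3)%R.
  by rewrite !lte_fin; split; lra.
- exists (a - 1)%R, (x - a + 2)%R; rewrite !lte_fin ltry; split=> //; lra.
- exists (x - b + 2)%R, (b - 1)%R; rewrite !lte_fin ltry; split=> //; lra.
- by exists (x + 1)%R, 0%R; rewrite !lte_fin !ltry; split=> //; lra.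
- by exists (a - 1)%R, (b - 1)%R; rewrite !lte_fin ltNyr; split=> //; lra.
- by exists (a - 1)%R, 0%R; rewrite !lte_fin ltNyr ltry; split=> //; lra.
- by exists 0%R, (b - 1)%R; rewrite !lte_fin ltNyr ltry; split=> //; lra.
- by exists 0%R, 0%R; rewrite ltNyr ltry.
Qed.

Lemma lt_sume_split (I : eqType) (r : seq I) (a : I -> \bar R) (x : \bar R) :
  uniq r -> x < \sum_(i <- r) a i ->
  exists c : I -> R, (forall i, i \in r -> (c i)%:E < a i) /\
                     x < (\sum_(i <- r) c i)%:E.
Proof.
elim: r x => [|i r IHr] x /=.
  by move=> _; rewrite big_nil => x0; exists (fun=> 0%R); rewrite big_nil.
move=> /andP[ir /IHr{}IHr]; rewrite big_cons => /lt_adde_split[y [z [ya]]].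
move=> /IHr[c [ca zc]] xyz; exists (fun k => if k == i then y else c k).
split=> [k|].
  rewrite inE; case: eqP => [-> //|_ /= kr]; exact: ca.
rewrite big_cons eqxx (eq_big_seq c) => [|k kr]; last first.
  by case: eqP kr ir => // -> ->.
by apply: (lt_trans xyz); rewrite lte_fin ltrD2l -lte_fin.
Qed.

(** Anything below the sum of the suprema is below a sum of reals [c i] with
    [c i] below the [i]-th supremum; as the variables are independent, points
    whose values exceed the [c i] can be chosen simultaneously. *)
Lemma ereal_sup_sum_indep (I : finType) (T : I -> Type)
    (f : forall i, T i -> \bar R) :
  ereal_sup (range (fun v : forall i, T i => \sum_i f i (v i))) =
  \sum_i ereal_sup (range (f i)).
Proof.
apply/eqP; rewrite eq_le; apply/andP; split.
  apply: ge_ereal_sup => _ [v _ <-]; apply: lee_sum => i _.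
  by apply: ereal_sup_ubound; exists (v i).
rewrite leNgt; apply/negP => /lt_sume_split[|c [csup]].
  exact: index_enum_uniq.
have v_gt i : exists v, (c i)%:E < f i v.
  by have /ereal_sup_gt[_ [v _ <-] cv] := csup i (mem_index_enum i); exists v.
pose v i := projT1 (cid (v_gt i)).
apply/negP; rewrite -leNgt.
apply: (@le_trans _ _ (\sum_i f i (v i))); last first.
  by apply: ereal_sup_ubound; exists v.
by rewrite -sumEFin; apply: lee_sum => i _; apply/ltW/(projT2 (cid (v_gt i))).
Qed.

Lemma big_lift (J : nat) (jl : 'I_J) (f : 'I_J -> \bar R) :
  \sum_(j < J) f j = f jl + \sum_(i < J.-1) f (lift jl i).
Proof. by case: J jl f => [[]|n] // jl f; exact: bigD1_ord. Qed.

(** Only the exchanged terms may be infinite; this form needs no case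
    distinction on them where it is applied. *)
Lemma leeBl_swap (a : R) (x y : \bar R) : a%:E - x <= y -> a%:E - y <= x.
Proof.
by case: x y => [x| |] [y| |] //=; rewrite ?leey ?leNye// -!EFinD !lee_fin; lra.
Qed.

End SupSum.

(** * The dual of the reduced problem *)

Section ReducedDual.
Context {R : realType} {J : nat} {V : 'I_J -> hilbertType R}
  {W : hilbertType R}.
Context (F : forall j, V j -> \bar R) (B : forall j, {linear V j -> W}).
Context (F_proper : forall j, eproper (F j)).
Context (g : W) (jl : 'I_J).
Local Open Scope ereal_scope.

Lemma conjugate_red_Phi (q : W) :
  conjugate (red_Phi F jl) (\- adjoint (red_B B jl) q)%R =
  \sum_(i < J.-1)
    conjugate (F (lift jl i)) (\- adjoint (B (lift jl i)) q)%R.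
Proof.
rewrite /conjugate -ereal_sup_sum_indep.
apply: (congr1 (fun f : red_var jl -> \bar R => ereal_sup (range f))).
apply/funext => v.
rewrite /red_Phi /red_B /adjoint /= big_split /= sumeN; last first.
  move=> i k _ _; have [FNy _] := F_proper (lift jl i).
  have [FNy' _] := F_proper (lift jl k); move: (FNy (v i)) (FNy' (v k)).
  by case: (F _ (v i)) => [?| |] //; case: (F _ (v k)) => [?| |].
by rewrite sumEFin raddf_sum -sumrN.
Qed.

(** The supremum over [w] and the infimum over the [v] with
    [- B_J v = w - g] merge into a single supremum over [v], in which
    [w = g - B_J v] is determined. *)
Lemma conjugate_red_Gamma (q : W) :
  conjugate (red_Gamma F B g jl) (inner q) =
  (inner q g)%:E + conjugate (F jl) (\- adjoint (B jl) q)%R.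
Proof.
apply/eqP; rewrite eq_le; apply/andP; split.
  apply: ge_ereal_sup => _ [w _ <-]; apply: leeBl_swap.
  apply: le_ereal_inf_tmp => _ [v /= Bv <-]; apply: leeBl_swap.
  have -> : inner q w = (inner q g + - inner q (B jl v))%R.
    by rewrite -(subrK g w) -Bv raddfD raddfN /= addrC.
  rewrite EFinD -addeA; apply: leeD2l; apply: ereal_sup_ubound.
  by exists v.
rewrite -leeBrDl//; apply: ge_ereal_sup => _ [v _ <-]; rewrite leeBrDl// addeA.
rewrite -EFinD; set w := (g - B jl v)%R.
have -> : (inner q g + (\- adjoint (B jl) q) v = inner q w)%R.
  by rewrite /adjoint /w raddfB.
apply: leeBl_swap; apply: (@le_trans _ _ (red_Gamma F B g jl w)).
  by apply: leeBl_swap; apply: ereal_sup_ubound; exists w.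
by apply: ereal_inf_lbound; exists v => //=; rewrite /w addrAC subrr add0r.
Qed.

End ReducedDual.

(** Only the last two blocks contribute, [- 1/2] each. *)
Lemma sum_curvature_shift (R : realType) (J : nat) :
  (2 <= J)%N -> \sum_(j < J) (2^-1 - gamma j) = -1 :> R.
Proof.
case: J => [|[|n]] // _; rewrite !big_ord_recr /= big1 => [|i _].
  by rewrite /gamma /= !ltnS ltnn ltnNge leqnSn /=; lra.
by rewrite /gamma /= !ltnS ltn_ord subrr.
Qed.

Lemma FR_dual_objE (R : realType) (J : nat) (V : 'I_J -> hilbertType R)
    (W : hilbertType R) (F : forall j, V j -> \bar R)
    (B : forall j, {linear V j -> W}) (g : W) (beta : R) (jl : 'I_J) (q : W) :
  (2 <= J)%N -> 0 < beta -> (forall j, eproper (F j)) ->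
  FR_dual_obj (red_Phi F jl) (red_Gamma F B g jl) (red_B B jl) q =
  dual_obj F B g beta q.
Proof.
move=> J2 beta_gt0 Fp.
rewrite /FR_dual_obj conjugate_red_Phi// conjugate_red_Gamma /dual_obj.
under [in RHS]eq_bigr do rewrite HfunE//.
rewrite big_split /= sumEFin -!mulr_suml sum_curvature_shift// (big_lift _ jl).
rewrite addeA [(_ + (inner q g)%:E)%E]addeC.
rewrite [RHS]addeC -[RHS]addeA -[in RHS]EFinD.
have -> : (-1 / beta * `|q| ^+ 2 + (beta^-1 * `|q| ^+ 2 + inner q g))%R
          = inner q g by ring.
by rewrite -addeA addeC; congr (_ + _)%E; exact: addeC.
Qed.

(** * The dualization theorem *)

Theorem theorem6p3 (R : realType) (J : nat) (hJ : (3 <= J)%N)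
    (V : 'I_J -> hilbertType R) (W : hilbertType R) (g : W)
    (F : forall j, V j -> \bar R) (B : forall j, {linear V j -> W})
    (beta : R)
    (F_proper : forall j, eproper (F j))
    (F_convex : forall j, econvex (F j))
    (F_lsc : forall j, lower_semicontinuous (F j))
    (B_bounded : forall j, bounded_near (B j) (nbhs (0 : V j)))
    (beta_gt0 : 0 < beta)
    (H_convex : forall j, econvex (Hfun F B beta j))
    (* standing assumptions *)
    (last_proper : eproper (last_postcomp F B (last_block hJ)))
    (last_lsc : lower_semicontinuous (last_postcomp F B (last_block hJ)))
    (last_attained : inf_postcomp_attained
       (fun v => - B (last_block hJ) v) (F (last_block hJ)))
    (PR_well_defined : forall c, exists q, PR_method F B beta c q)
    (ADMM_well_defined : forall c, exists u, ADMM_method F B beta c u)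
    (global_qualified : qualified (red_Phi F (last_block hJ))
       (red_Gamma F B g (last_block hJ)) (red_B B (last_block hJ)))
    (local_qualified : forall s lam uhat u, ADMM_run F B beta s lam uhat u ->
       forall (n : nat) (j : 'I_J),
         qualified (F j) (ADMM_penalty beta j (lam (n * J + j)%N) (s n j))
           (B j)) :
  [/\ (* the dual objective is that of the dual of the reduced problem *)
      forall q, FR_dual_obj (red_Phi F (last_block hJ))
                  (red_Gamma F B g (last_block hJ))
                  (red_B B (last_block hJ)) q
                = dual_obj F B g beta q,
      is_dualization (PR_method F B beta)
        (red_ADMM_method F B beta (last_block hJ))
        (primal_dual_rel F B (last_block hJ)) &
      forall p r s lam uhat u,
        PR_run F B beta p r -> ADMM_run F B beta s lam uhat u ->
        (forall j, s 0%N j = r 0%N j) -> lam 0%N = p 0%N ->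
        forall n, (1 <= n)%N -> forall j : 'I_J,
          [/\ s n j = r n j, lam (n * J)%N = p (n * J)%N &
              subdiff (F j) (u n j) (\- adjoint (B j) (p (n * J)%N))]].
Proof.
have agree := runs_agree F B beta beta_gt0.
have duals p r s lam uhat u :
    PR_run F B beta p r -> ADMM_run F B beta s lam uhat u ->
    (forall j, s 0%N j = r 0%N j) -> lam 0%N = p 0%N ->
    forall n, (1 <= n)%N -> forall j : 'I_J,
      [/\ s n j = r n j, lam (n * J)%N = p (n * J)%N &
          subdiff (F j) (u n j) (\- adjoint (B j) (p (n * J)%N))].
  move=> PR AD s0 l0 [//|n] _ j.
  have [lp sr] := agree _ _ _ _ _ _ F_proper F_convex PR AD s0 l0 n.+1.
  by split=> //; rewrite -lp; have [_] := AD n; exact.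
split=> // [q|d].
  by apply: FR_dual_objE => //; exact: ltnW.
have [u0 u0run] := ADMM_well_defined d; exists d.
  by exists (fun n => restrict_last (last_block hJ) (u0 n)), u0.
move=> q u' [p [r [PR p0 r0 qp]]] [u [[s [lam [uhat [AD l0 s0]]]] ->]] n n1 i.
have sr j : s 0%N j = r 0%N j by rewrite s0 r0.
have lp : lam 0%N = p 0%N by rewrite l0 p0.
rewrite qp.
by have [] := duals _ _ _ _ _ _ PR AD sr lp n n1 (lift (last_block hJ) i).
Qed.
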